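(* Suppose that $S=U\bowtie A$ is a Zappa–Szép product of monoids such that $S$ and $U$ are right LCM semigroups, $S_c=U_c\bowtie A$, and for all $(u,a),(v,b)\in S$ one has $(u,a)\sim(v,b)$ in $S$ if and only if $u\sim v$ in $U$. If $U_c$ is trivial (i.e. $U_c=\{1\}$), then the following statements hold: (i) The action $\alpha\colon S_c\curvearrowright S/_\sim$ is faithful if and only if $\gamma\colon A\curvearrowright U/_\sim$ is faithful. (ii) The action $\alpha$ is almost free if and only if $\gamma$ is almost free.
   Context: All semigroups are countable discrete monoids. **Zappa–Szép products.** Let $U,A$ be monoids with maps $A\times U\to U$, $(a,u)\mapsto a(u)$ (action) and $A\times U\to A$, $(a,u)\mapsto a|_u$ (restriction) such that $1(u)=u$; $(ab)(u)=a(b(u))$; $a(1)=1$; $a|_1=a$; $1|_u=1$; $a|_{uv}=(a|_u)|_v$; $a(uv)=a(u)\,a|_u(v)$; $(ab)|_u=a|_{b(u)}\,b|_u$. Then $U\bowtie A$ is the set $U\times A$ with multiplication $(u,a)(v,b)=(u\,a(v),\,a|_v\,b)$. The equality $S_c=U_c\bowtie A$ means $S_c=U_c\times A$ as a subset of $U\times A$, with $a(u)\in U_c$ for $a\in A$, $u\in U_c$. **Right LCM semigroups.** A monoid $S$ is right LCM if it is left cancellative and for all $s,t\in S$ the set $sS\cap tS$ is empty or of the form $rS$. $S_c=\{a\in S: aS\cap sS\ne\emptyset\ \forall s\in S\}$ is the core subsemigroup, and $s\sim t$ means $sa=tb$ for some $a,b\in S_c$; $[s]$ is the class of $s$. The same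 notation is used for $U$. **Actions.** $\alpha\colon S_c\curvearrowright S/_\sim$ is given by $\alpha_a([s])=[as]$, and $\gamma\colon A\curvearrowright U/_\sim$ by $\gamma_a([u])=[a(u)]$ (well defined here). An action $\gamma\colon T\curvearrowright X$ of a monoid $T$ on a set $X$ is faithful if for all $s\ne t$ in $T$ there is $x\in X$ with $\gamma_s(x)\neq\gamma_t(x)$, and almost free if $\{x\in X:\gamma_s(x)=\gamma_t(x)\}$ is finite for all $s\neq t$ in $T$. *)

(* Defs.v *)
From HB Require Import structures.
From mathcomp Require Import all_boot monoid generic_quotient.
From mathcomp Require Import boolp classical_sets functions cardinality.

Set Implicit Arguments.
Unset Strict Implicit.
Unset Printing Implicit Defensive.

Local Open Scope classical_set_scope.
Local Open Scope quotient_scope.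
Local Open Scope group_scope.

Section RightLCM.
Variable S : monoidType.
Implicit Types s t a b : S.

Definition rideal s : set S := range (fun x : S => s * x).

Definition left_cancellative : Prop :=
  forall s t u : S, s * t = s * u -> t = u.

Definition right_lcm : Prop :=
  left_cancellative /\
  forall s t, rideal s `&` rideal t = set0 \/
              exists r, rideal s `&` rideal t = rideal r.

Definition core : set S := [set a | forall s, rideal a `&` rideal s !=set0].

Definition core_sim s t : Prop :=
  exists a b, [/\ core a, core b & s * a = t * b].

Lemma core1 : core 1.
Proof.
by move=> s; exists s; split; [exists s|exists 1] => //; rewrite ?mul1g ?mulg1.
Qed.

Lemma coreM a b : core a -> core b -> core (a * b).
Proof.
move=> ca cb s; have [_ [[x _ <-] [y _ yx]]] := ca s.
have [_ [[z _ <-] [w _ wz]]] := cb x; exists (a * b * z); split; first by exists z.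
by exists (y * w) => //; rewrite mulgA yx -mulgA wz mulgA.
Qed.

Lemma core_lcm a b r : right_lcm -> core a -> core b ->
  rideal a `&` rideal b = rideal r -> core r.
Proof.
move=> [_ lcmS] ca cb rE s; rewrite -rE.
have [bs0|[q qE]] := lcmS b s; first by have [x] := cb s; rewrite bs0.
by rewrite -setIA qE; exact: ca.
Qed.

Lemma core_mulI a b : left_cancellative -> core (a * b) -> core b.
Proof.
move=> cS cab s; have [_ [[x _ <-] [y _ yx]]] := cab (a * s).
exists (b * x); split; first by exists x.
by exists y => //; apply: (cS a); rewrite !mulgA.
Qed.

Lemma core_sim_refl s : core_sim s s.
Proof. by exists 1, 1; split=> //; exact: core1. Qed.

Lemma core_sim_sym s t : core_sim s t -> core_sim t s.
Proof. by move=> [a [b [ca cb e]]]; exists b, a. Qed.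

Lemma core_sim_trans s t u : right_lcm ->
  core_sim s t -> core_sim t u -> core_sim s u.
Proof.
move=> lS [a [b [ca cb sab]]] [c [d [cc cd tcd]]].
have [bc0|[r rE]] := lS.2 b c; first by have [x] := cb c; rewrite bc0.
have cr : core r := core_lcm lS cb cc rE.
have : rideal r r by exists 1 => //; rewrite mulg1.
rewrite -rE => -[[e _ re] [f _ rf]].
have ce : core e by apply: (core_mulI (a := b)) lS.1 _; rewrite re.
have cf : core f by apply: (core_mulI (a := c)) lS.1 _; rewrite rf.
exists (a * e), (d * f); split; try exact: coreM.
by rewrite mulgA sab -mulgA re -rf !mulgA tcd.
Qed.

Lemma core_simMl s t u : core_sim s t -> core_sim (u * s) (u * t).
Proof. by move=> [a [b [ca cb e]]]; exists a, b; rewrite -!mulgA e. Qed.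

Section Quotient.
Hypothesis lS : right_lcm.

Definition core_simb : rel S := fun s t => `[<core_sim s t>].

Lemma core_simb_refl : reflexive core_simb.
Proof. by move=> s; apply/asboolP; exact: core_sim_refl. Qed.

Lemma core_simb_sym : symmetric core_simb.
Proof. by move=> s t; apply/asboolP/asboolP; exact: core_sim_sym. Qed.

Lemma core_simb_trans : transitive core_simb.
Proof.
move=> t s u /asboolP st /asboolP tu; apply/asboolP.
exact: core_sim_trans st tu.
Qed.

Definition core_equiv : equiv_rel S :=
  EquivRel core_simb core_simb_refl core_simb_sym core_simb_trans.

Definition core_quot : Type := {eq_quot core_equiv}.
HB.instance Definition _ := EqQuotient.copy core_quot {eq_quot core_equiv}.

Lemma core_quotP s t : \pi_core_quot s = \pi_core_quot t <-> core_sim s t.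
Proof.
split=> [/(@eqquotP _ core_equiv core_quot)/asboolP // | st].
by apply/(@eqquotP _ core_equiv core_quot)/asboolP.
Qed.

(* Computed on a representative; alphaE shows that the choice is irrelevant. *)
Definition alpha (a : core) (x : core_quot) : core_quot :=
  \pi_core_quot (val a * repr x).

Lemma alphaE (a : core) s :
  alpha a (\pi_core_quot s) = \pi_core_quot (val a * s).
Proof. by apply/core_quotP/core_simMl/core_quotP; rewrite reprK. Qed.

Lemma alpha1 (e : core) x : val e = 1 -> alpha e x = x.
Proof. by move=> e1; rewrite -[x]reprK alphaE e1 mul1g. Qed.

Lemma alphaM (a b c : core) x :
  val c = val a * val b -> alpha c x = alpha a (alpha b x).
Proof. by move=> cE; rewrite -[x]reprK !alphaE cE mulgA reprK. Qed.

End Quotient.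
End RightLCM.

Arguments core S : clear implicits.
Arguments right_lcm S : clear implicits.

(* zs_act a u is a(u) and zs_res a u is a|_u *)
Record zappa_szep (U A : monoidType) := ZappaSzep {
  zs_act : A -> U -> U;
  zs_res : A -> U -> A;
  zs_act1l : forall u, zs_act 1 u = u;
  zs_actMl : forall a b u, zs_act (a * b) u = zs_act a (zs_act b u);
  zs_act1r : forall a, zs_act a 1 = 1;
  zs_res1r : forall a, zs_res a 1 = a;
  zs_res1l : forall u, zs_res 1 u = 1;
  zs_resMr : forall a u v, zs_res a (u * v) = zs_res (zs_res a u) v;
  zs_actMr : forall a u v,
    zs_act a (u * v) = zs_act a u * zs_act (zs_res a u) v;
  zs_resMl : forall a b u,
    zs_res (a * b) u = zs_res a (zs_act b u) * zs_res b u
}.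

(* An alias of U * A, carrying the twisted monoid structure instead of the
   componentwise one. *)
Definition zs_prod (U A : monoidType) (Z : zappa_szep U A) : Type :=
  (U * A)%type.

Section ZSProd.
Variables (U A : monoidType) (Z : zappa_szep U A).
Local Notation S := (zs_prod Z).

Definition zs_pair (u : U) (a : A) : S := (u, a).

Definition zs_one : S := (1, 1).

Definition zs_mul (s t : S) : S :=
  (s.1 * zs_act Z s.2 t.1, zs_res Z s.2 t.1 * t.2).

Lemma zs_mulA : associative zs_mul.
Proof.
move=> [u a] [v b] [w c]; rewrite /zs_mul /=; congr pair.
  by rewrite zs_actMr zs_actMl !mulgA.
by rewrite zs_resMr zs_resMl !mulgA.
Qed.

Lemma zs_mul1g : left_id zs_one zs_mul.
Proof. by move=> [u a]; rewrite /zs_mul /= zs_act1l zs_res1l !mul1g. Qed.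

Lemma zs_mulg1 : right_id zs_one zs_mul.
Proof. by move=> [u a]; rewrite /zs_mul /= zs_act1r zs_res1r !mulg1. Qed.

HB.instance Definition _ := Choice.copy S (U * A)%type.
HB.instance Definition _ := isMonoid.Build S zs_mulA zs_mul1g zs_mulg1.

Definition core_splits : Prop :=
  core S = core U `*` setT /\ forall a u, core U u -> core U (zs_act Z a u).

Definition sim_splits : Prop :=
  forall u a v b,
    core_sim (zs_pair u a) (zs_pair v b) <-> core_sim u v.

(* Computed on a representative; gammaE shows that the choice is irrelevant
   when ~ on S is determined by the first component. *)
Definition gamma (lU : right_lcm U) (a : A) (x : core_quot lU) : core_quot lU :=
  \pi_(core_quot lU) (zs_act Z a (repr x)).

Lemma gammaE (lU : right_lcm U) (a : A) u : sim_splits ->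
  gamma a (\pi_(core_quot lU) u) = \pi_(core_quot lU) (zs_act Z a u).
Proof.
move=> hs; apply/core_quotP.
have uE : core_sim (repr (\pi_(core_quot lU) u)) u.
  by apply/(core_quotP lU); rewrite reprK.
have /(core_simMl (zs_pair 1 a)) := (hs _ 1 _ 1).2 uE.
by move=> /hs; rewrite !mul1g.
Qed.

Lemma gamma1 (lU : right_lcm U) (x : core_quot lU) :
  sim_splits -> gamma 1 x = x.
Proof. by move=> hs; rewrite -[x]reprK gammaE // zs_act1l. Qed.

Lemma gammaM (lU : right_lcm U) (a b : A) (x : core_quot lU) :
  sim_splits -> gamma (a * b) x = gamma a (gamma b x).
Proof. by move=> hs; rewrite -[x]reprK !gammaE // zs_actMl reprK. Qed.

End ZSProd.

Section Actions.
Variables (T X : Type) (act : T -> X -> X).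

Definition faithful_action : Prop :=
  forall s t : T, s <> t -> exists x, act s x <> act t x.

Definition almost_free_action : Prop :=
  forall s t : T, s <> t -> finite_set [set x | act s x = act t x].

End Actions.

(* Main.v *)
Require Import Defs.
From mathcomp Require Import all_boot monoid generic_quotient.
From mathcomp Require Import boolp classical_sets functions cardinality.

(** When the core of U is trivial, the actions alpha and gamma are conjugate,
    and both faithfulness and almost freeness are invariant under conjugacy.

    On the acting monoids, the core of the product is {1} x A, so that
    a |-> (1, a) is a bijection from A onto it ([core_inclusion_bij]).  On the
    spaces, [u] |-> [(u, 1)] is a bijection from U/~ onto S/~, because
    equivalence in S only sees the first component ([class_inclusion_bij]).
    These two bijections intertwine the actions ([class_inclusion_gamma]):
    (1, a)(u, 1) = (a(u), a|_u), and the restriction a|_u is invisible in S/~. *)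

Set Implicit Arguments.
Unset Strict Implicit.
Unset Printing Implicit Defensive.

Local Open Scope classical_set_scope.
Local Open Scope quotient_scope.
Local Open Scope group_scope.

Section ConjugateActions.
Variables (T T' X X' : Type) (act : T -> X -> X) (act' : T' -> X' -> X').
Variables (g : T -> T') (f : X -> X').
Hypotheses (g_bij : bijective g) (f_bij : bijective f).
Hypothesis fg : forall t x, f (act t x) = act' (g t) (f x).

Lemma conjugate_coincidence s t x :
  act s x = act t x <-> act' (g s) (f x) = act' (g t) (f x).
Proof. by rewrite -!fg; split=> [->//|/(bij_inj f_bij)]. Qed.

Lemma conjugate_faithful : faithful_action act <-> faithful_action act'.
Proof.
have [g' gK g'K] := g_bij; have [f' fK f'K] := f_bij.
split=> faith s t st.
  have [|x nx] := faith (g' s) (g' t); first by move/(can_inj g'K).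
  by exists (f x) => e; apply/nx/conjugate_coincidence; rewrite !g'K.
have [|y ny] := faith (g s) (g t); first by move/(can_inj gK).
by exists (f' y) => /conjugate_coincidence; rewrite f'K.
Qed.

(** The coincidence set of g s and g t is the image under f of that of s
    and t, so that one is finite if and only if the other is. *)
Lemma conjugate_almost_free :
  almost_free_action act <-> almost_free_action act'.
Proof.
have [g' gK g'K] := g_bij; have [f' fK f'K] := f_bij.
split=> free s t st.
  have /free/(finite_image f) : g' s <> g' t by move/(can_inj g'K).
  apply: sub_finite_set => y /= e; exists (f' y); last exact: f'K.
  by apply/conjugate_coincidence; rewrite f'K !g'K.
have /free/(finite_image f') : g s <> g t by move/(can_inj gK).
apply: sub_finite_set => x /= e; exists (f x); last exact: fK.
exact/conjugate_coincidence.
Qed.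

End ConjugateActions.

Section AlphaGamma.
Variables (U A : monoidType) (Z : zappa_szep U A).
Hypotheses (lcmS : right_lcm (zs_prod Z)) (lcmU : right_lcm U).

Lemma core_pair1 (coreS : core_splits Z) a : core (zs_prod Z) (zs_pair Z 1 a).
Proof. by rewrite coreS.1; split=> //; exact: core1. Qed.

Definition core_inclusion (coreS : core_splits Z) (a : A) : core (zs_prod Z) :=
  exist _ (zs_pair Z 1 a) (mem_set (core_pair1 coreS a)).

Lemma core_inclusion_bij (coreS : core_splits Z) :
  core U = [set 1] -> bijective (core_inclusion coreS).
Proof.
move=> coreU1; exists (fun c => (val c).2) => // -[[u a] c_ua]; apply: val_inj => /=.
by have := set_mem c_ua; rewrite coreS.1 coreU1 => -[/= -> _].
Qed.

Definition class_inclusion (y : core_quot lcmU) : core_quot lcmS :=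
  \pi_(core_quot lcmS) (zs_pair Z (repr y) 1).

Hypothesis simS : sim_splits Z.

Lemma core_sim_fst (s t : zs_prod Z) : core_sim s t <-> core_sim s.1 t.1.
Proof. by case: s t => [u a] [v b]; exact: simS. Qed.

Lemma class_inclusion_bij : bijective class_inclusion.
Proof.
exists (fun x : core_quot lcmS =>
    \pi_(core_quot lcmU) (repr x : zs_prod Z).1) => [y|x].
  rewrite -[RHS]reprK; apply/core_quotP.
  apply/(core_sim_fst _ (zs_pair Z (repr y) 1)).
  by apply/(core_quotP lcmS); rewrite reprK.
rewrite -[RHS]reprK; apply/core_quotP/core_sim_fst.
by apply/(core_quotP lcmU); rewrite reprK.
Qed.

Lemma class_inclusion_gamma (coreS : core_splits Z) a y :
  class_inclusion (gamma Z a y) =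
  alpha (core_inclusion coreS a) (class_inclusion y).
Proof.
rewrite alphaE; apply/core_quotP.
(* The second component of (1, a)(u, 1) is a|_u 1, which [simS] discards. *)
have -> : val (core_inclusion coreS a) * zs_pair Z (repr y) 1 =
    zs_pair Z (zs_act Z a (repr y)) (zs_res Z a (repr y) * 1).
  by congr pair; exact: mul1g.
by apply/simS/(core_quotP lcmU); rewrite reprK.
Qed.

End AlphaGamma.

Theorem corollary5p6 (U A : monoidType) (Z : zappa_szep U A)
    (countU : countable [set: U]%classic) (countA : countable [set: A]%classic)
    (lcmS : right_lcm (zs_prod Z)) (lcmU : right_lcm U)
    (coreS : core_splits Z) (simS : sim_splits Z)
    (coreU1 : core U = [set 1%g]%classic) :
  (faithful_action (alpha (lS := lcmS)) <->
     faithful_action (gamma Z (lU := lcmU))) /\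
  (almost_free_action (alpha (lS := lcmS)) <->
     almost_free_action (gamma Z (lU := lcmU))).
Proof.
have g_bij := core_inclusion_bij coreS coreU1.
have f_bij := class_inclusion_bij lcmS lcmU simS.
have fg := class_inclusion_gamma lcmS (lcmU := lcmU) simS coreS.
split; apply: iff_sym.
  exact: (conjugate_faithful g_bij f_bij fg).
exact: (conjugate_almost_free g_bij f_bij fg).
Qed.
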